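(* Let $\mathbf{F}$ be a Fraïssé structure in $L$ and let $\mathbf{F}^{*}$ be a Fraïssé precompact relational expansion of $\mathbf{F}$ in $L^{*}$. Let $G=\mathrm{Aut}(\mathbf{F})$ and $G^{*}=\mathrm{Aut}(\mathbf{F}^{*})\leq G$. Then the following are equivalent: (i) The pair $(G,G^{*})$ is relatively extremely amenable. (ii) The elements of $\mathrm{Age}(\mathbf{F}^{*})$ are rigid and the pair $(\mathrm{Age}(\mathbf{F}),\mathrm{Age}(\mathbf{F}^{*}))$ has the relative Ramsey property for embeddings.
   Context: $\mathbb{N}=\{0,1,2,\ldots\}$ and $[k]=\{0,\ldots,k-1\}$. $L$ is a countable first-order signature and $L^{*}=L\cup\{R_i : i\in I^{*}\}$, where $I^{*}$ is countable and each $R_i$ is a relation symbol not in $L$, of arity $\alpha(i)$. A Fraïssé structure is a countable (infinite), locally finite (finitely generated substructures are finite), ultrahomogeneous structure (every isomorphism between finite substructures extends to an automorphism). $\mathrm{Age}(\mathbf{F})$ is the class of finite structures that embed in $\mathbf{F}$. An expansion $\mathbf{F}^{*}$ of $\mathbf{F}$ in $L^{*}$ is an $L^{*}$-structure whose $L$-reduct is $\mathbf{F}$; ''Fraïssé expansion'' means $\mathbf{F}^{*}$ is itself a Fraïssé structure in $L^{*}$. It is precompact if every element of $\mathrm{Age}(\mathbf{F})$ has only finitely many expansions in $\mathrm{Age}(\mathbf{F}^{*})$. Both $\mathbf{F}$ and $\mathbf{F}^{*}$ have universe $\mathbb{N}$, so $G^{*}\leq G$ are closed subgroups of $S_\infty$,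 the group of permutations of $\mathbb{N}$ with the topology of pointwise convergence. A structure is rigid if its only automorphism is the identity. All topological spaces are Hausdorff. For topological groups $H\leq G$, the pair $(G,H)$ is relatively extremely amenable if every continuous action of $G$ on every (nonempty) compact space admits a point fixed by every element of $H$. A class $\mathcal{K}^{*}$ of $L^{*}$-structures is an expansion in $L^{*}$ of a class $\mathcal{K}$ of $L$-structures if every element of $\mathcal{K}^{*}$ is an expansion of an element of $\mathcal{K}$ and every element of $\mathcal{K}$ has an expansion in $\mathcal{K}^{*}$. For $\mathbf{B}^{*}\in\mathcal{K}^{*}$, $\mathbf{B}$ denotes its $L$-reduct. For $L$-structures, $\binom{\mathbf{B}}{\mathbf{A}}_{\mathrm{Emb}}$ denotes the set of embeddings of $\mathbf{A}$ into $\mathbf{B}$. If $\mathbf{B}^{*}$ is an expansion of $\mathbf{B}$ and $a\in\binom{\mathbf{B}}{\mathbf{A}}_{\mathrm{Emb}}$, the canonical expansion of $\mathbf{A}$ induced by $a$ is $(\mathbf{A},(R^{a}_i)_{i\in I^{*}})$, where $R^{a}_i(x_1,\ldots,x_{\alpha(i)})\Leftrightarrow R^{\mathbf{B}^{*}}_i(a(x_1),\ldots,a(x_{\alpha(i)}))$ for $i\in I^{*}$. Write $a\cong_{\mathbf{B}^{*}}a'$ if the canonical expansions of $\mathbf{A}$ induced by $a$ and $a'$ are equal (not only isomorphic). For $\mathcal{K}$ a class of finite $L$-structures and $\mathcal{K}^{*}$ an expansion of $\mathcal{K}$ in $L^{*}$, the pair $(\mathcal{K},\mathcal{K}^{*})$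 has the relative Ramsey property for embeddings if for every $k\in\mathbb{N}$, $\mathbf{A}\in\mathcal{K}$, $\mathbf{B}^{*}\in\mathcal{K}^{*}$, there exists $\mathbf{C}\in\mathcal{K}$ such that for every coloring $c:\binom{\mathbf{C}}{\mathbf{A}}_{\mathrm{Emb}}\to[k]$ there exists $b\in\binom{\mathbf{C}}{\mathbf{B}}_{\mathrm{Emb}}$ such that for all $a_0,a_1\in\binom{\mathbf{B}}{\mathbf{A}}_{\mathrm{Emb}}$, $a_0\cong_{\mathbf{B}^{*}}a_1$ implies $c(ba_0)=c(ba_1)$. *)

(* Defs.v *)
From HB Require Import structures.
From mathcomp Require Import all_boot.
From mathcomp Require Import boolp classical_sets functions cardinality filter.
From mathcomp Require Import topology.

Set Implicit Arguments.
Unset Strict Implicit.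
Unset Printing Implicit Defensive.

Local Open Scope classical_set_scope.

(* Constants are the function symbols of arity 0. *)
Record signature := Signature {
  funsym : countType;
  funsym_arity : funsym -> nat;
  relsym : countType;
  relsym_arity : relsym -> nat
}.

(* The universe is a parameter, so that two structures on the same universe can
   be compared with Leibniz equality.  Empty universes are allowed. *)
Record structure (L : signature) (T : Type) := Structure {
  funI : forall f : funsym L, ('I_(funsym_arity f) -> T) -> T;
  relI : forall r : relsym L, ('I_(relsym_arity r) -> T) -> Prop
}.

Arguments funI {L T} M f x : rename.
Arguments relI {L T} M r x : rename.

Record embedding (L : signature) (TA TB : Type)
    (A : structure L TA) (B : structure L TB) := Embedding {
  emb_fun :> TA -> TB;
  emb_inj : injective emb_fun;
  emb_funI : forall (f : funsym L) (x : 'I_(funsym_arity f) -> TA),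
    emb_fun (funI A f x) = funI B f (emb_fun \o x);
  emb_relI : forall (r : relsym L) (x : 'I_(relsym_arity r) -> TA),
    relI A r x <-> relI B r (emb_fun \o x)
}.

Record iso (L : signature) (TA TB : Type)
    (A : structure L TA) (B : structure L TB) := Iso {
  iso_emb :> embedding A B;
  iso_bij : bijective iso_emb
}.

Definition aut (L : signature) (T : Type) (M : structure L T) : Type := iso M M.

Section EmbeddingOps.
Context (L : signature) (TA TB TC : Type).
Context (A : structure L TA) (B : structure L TB) (C : structure L TC).

Lemma emb_ext (e e' : embedding A B) : (e : TA -> TB) =1 e' -> e = e'.
Proof.
case: e e' => [f i u r] [f' i' u' r'] /= ff'.
have {}ff' : f = f' by exact: functional_extensionality_dep.
by subst f'; congr Embedding; exact: Prop_irrelevance.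
Qed.

Lemma iso_ext (e e' : iso A B) : (e : TA -> TB) =1 e' -> e = e'.
Proof.
case: e e' => [e b] [e' b'] /= ee'.
have {}ee' : e = e' by exact: emb_ext.
by subst e'; congr Iso; exact: Prop_irrelevance.
Qed.

Section Composition.
Context (b : embedding B C) (a : embedding A B).

Let comp_inj : injective (b \o a).
Proof. exact: inj_comp (@emb_inj _ _ _ _ _ b) (@emb_inj _ _ _ _ _ a). Qed.

Let comp_funI (f : funsym L) (x : 'I_(funsym_arity f) -> TA) :
  (b \o a) (funI A f x) = funI C f ((b \o a) \o x).
Proof. by rewrite /= !emb_funI. Qed.

Let comp_relI (r : relsym L) (x : 'I_(relsym_arity r) -> TA) :
  relI A r x <-> relI C r ((b \o a) \o x).
Proof. by rewrite (emb_relI a) (emb_relI b). Qed.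

Definition emb_comp : embedding A C :=
  @Embedding _ _ _ A C (b \o a) comp_inj comp_funI comp_relI.

End Composition.

Definition iso_comp (b : iso B C) (a : iso A B) : iso A C :=
  @Iso _ _ _ A C (emb_comp b a) (bij_comp (iso_bij b) (iso_bij a)).

Definition emb_id : embedding A A :=
  @Embedding _ _ _ A A id (@inj_id _) (fun _ _ => erefl)
    (fun _ _ => iff_refl _).

Definition iso_id : iso A A := @Iso _ _ _ A A emb_id (Bijective (frefl id) (frefl id)).

End EmbeddingOps.

Section Substructures.
Context (L : signature) (T : Type) (M : structure L T).

Definition closed_under (X : set T) : Prop :=
  forall (f : funsym L) (x : 'I_(funsym_arity f) -> T),
    (forall i, X (x i)) -> X (funI M f x).

Definition generated (X : set T) : set T := smallest closed_under X.

Lemma closed_under_val (X : set T) (hX : closed_under X) (f : funsym L)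
  (x : 'I_(funsym_arity f) -> X) : funI M f (fun i => val (x i)) \in X.
Proof. by apply/mem_set/hX => i; exact/set_mem/valP. Qed.

(* Here [X : set T] coerces to the subtype of its elements. *)
Definition substructure (X : set T) (hX : closed_under X) : structure L X :=
  @Structure L X
    (fun f x => Sub (funI M f (fun i => val (x i))) (closed_under_val hX x))
    (fun r x => relI M r (fun i => val (x i))).

Definition locally_finite : Prop :=
  forall X : set T, finite_set X -> finite_set (generated X).

Definition ultrahomogeneous : Prop :=
  forall (X Y : set T) (hX : closed_under X) (hY : closed_under Y),
    finite_set X -> finite_set Y ->
    forall f : iso (substructure hX) (substructure hY),
      exists g : aut M, forall x : X, g (val x) = val (f x).

Definition fraisse : Prop :=
  [/\ countable [set: T], infinite_set [set: T],
      locally_finite & ultrahomogeneous].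

Definition rigid : Prop := forall g : aut M, g =1 id.

End Substructures.

Definition structure_class (L : signature) : Type :=
  forall T : Type, structure L T -> Prop.

Definition Age (L : signature) (T : Type) (F : structure L T) :
    structure_class L :=
  fun TA A => finite_set [set: TA] /\ inhabited (embedding A F).

Section Expansions.
Context (L : signature) (I : countType) (alpha : I -> nat).

(* Using a disjoint sum makes the new symbols automatically not in [L]. *)
Definition expand : signature :=
  @Signature (funsym L) (@funsym_arity L) (relsym L + I)%type
    (fun s => match s with inl r => relsym_arity r | inr i => alpha i end).

Definition reduct (T : Type) (M : structure expand T) : structure L T :=
  @Structure L T (@funI expand T M) (fun r => @relI expand T M (inl r)).

Definition canonical_expansion (TA TB : Type) (A : structure L TA)
    (Bs : structure expand TB) (a : embedding A (reduct Bs)) :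
    structure expand TA :=
  @Structure expand TA (funI A)
    (fun s => match s return
        ('I_(@relsym_arity expand s) -> TA) -> Prop with
      | inl r => relI A r
      | inr i => fun x => @relI expand TB Bs (inr i) (a \o x)
      end).

Definition precompact_expansion (T : Type) (F : structure L T)
    (Fs : structure expand T) : Prop :=
  forall (TA : Type) (A : structure L TA), Age F A ->
    finite_set [set As : structure expand TA | reduct As = A /\ Age Fs As].

Definition relative_ramsey_emb (K : structure_class L)
    (Ks : structure_class expand) : Prop :=
  forall (k : nat) (TA : Type) (A : structure L TA)
    (TB : Type) (Bs : structure expand TB),
  K TA A -> Ks TB Bs ->
  exists (TC : Type) (C : structure L TC), K TC C /\
    forall c : embedding A C -> 'I_k,
    exists b : embedding (reduct Bs) C,
    forall a0 a1 : embedding A (reduct Bs),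
      canonical_expansion a0 = canonical_expansion a1 ->
      c (emb_comp b a0) = c (emb_comp b a1).

End Expansions.

HB.mixin Record isTopologicalGroup G of Group G & Topological G := {
  mulg_continuous : continuous (fun p : G * G => (p.1 * p.2)%g);
  invg_continuous : continuous (fun g : G => (g^-1)%g)
}.

#[short(type="topologicalGroupType")]
HB.structure Definition TopologicalGroup :=
  {G of isTopologicalGroup G & Group G & Topological G}.

Definition is_continuous_action (G : topologicalGroupType)
    (X : topologicalType) (act : G -> X -> X) : Prop :=
  [/\ forall x, act 1%g x = x,
      forall g h x, act (g * h)%g x = act g (act h x)
    & continuous (fun p : G * X => act p.1 p.2)].

Definition relatively_extremely_amenable (G : topologicalGroupType)
    (H : set G) : Prop :=
  forall (X : topologicalType) (act : G -> X -> X),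
    hausdorff_space X -> compact [set: X] -> [set: X] !=set0 ->
    is_continuous_action act ->
    exists x : X, forall h, H h -> act h x = x.

Section AutGroup.
Context (L : signature) (T : Type) (M : structure L T).

Let autinv (g : aut M) : {h : T -> T | cancel g h /\ cancel h g}.
Proof. by apply: cid; case: (iso_bij g) => h gh hg; exists h. Qed.

Section Inverse.
Variable g : aut M.

Let gK : cancel g (sval (autinv g)). Proof. by case: (svalP (autinv g)). Qed.
Let gVK : cancel (sval (autinv g)) g. Proof. by case: (svalP (autinv g)). Qed.

Let comp_gV (n : nat) (x : 'I_n -> T) : g \o (sval (autinv g) \o x) = x.
Proof. by apply/funext => i; exact: gVK. Qed.

Let inv_funI (f : funsym L) (x : 'I_(funsym_arity f) -> T) :
  sval (autinv g) (funI M f x) = funI M f (sval (autinv g) \o x).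
Proof. by rewrite -[RHS]gK emb_funI comp_gV. Qed.

Let inv_relI (r : relsym L) (x : 'I_(relsym_arity r) -> T) :
  relI M r x <-> relI M r (sval (autinv g) \o x).
Proof. by rewrite [X in _ <-> X](emb_relI g) comp_gV. Qed.

Definition aut_inv : aut M :=
  @Iso _ _ _ M M
    (@Embedding _ _ _ M M (sval (autinv g)) (can_inj gVK) inv_funI inv_relI)
    (Bijective gVK gK).

End Inverse.

Lemma aut_invK (g : aut M) : cancel g (aut_inv g).
Proof. by case: (svalP (autinv g)). Qed.

Lemma aut_invVK (g : aut M) : cancel (aut_inv g) g.
Proof. by case: (svalP (autinv g)). Qed.

HB.instance Definition _ := gen_eqMixin (aut M).
HB.instance Definition _ := gen_choiceMixin (aut M).

Let autA : associative (fun g h : aut M => iso_comp g h).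
Proof. by move=> f g h; apply: iso_ext. Qed.

Let aut1g : left_id (iso_id M) (fun g h : aut M => iso_comp g h).
Proof. by move=> g; apply: iso_ext. Qed.

Let autg1 : right_id (iso_id M) (fun g h : aut M => iso_comp g h).
Proof. by move=> g; apply: iso_ext. Qed.

Let autVg :
  left_inverse (iso_id M) aut_inv (fun g h : aut M => iso_comp g h).
Proof. by move=> g; apply: iso_ext => x /=; exact: aut_invK. Qed.

Let autgV :
  right_inverse (iso_id M) aut_inv (fun g h : aut M => iso_comp g h).
Proof. by move=> g; apply: iso_ext => x /=; exact: aut_invVK. Qed.

HB.instance Definition _ :=
  isGroup.Build (aut M) autA aut1g autg1 autVg autgV.

End AutGroup.

(* For universe [nat] (with its discrete topology), the topology of pointwise
   convergence, i.e. the subspace topology inherited from S_infty. *)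
Definition aut_ptws (L : signature) (M : structure L nat) (g : aut M) :
  {ptws nat -> nat} := g.

Section AutTopology.
Context (L : signature) (M : structure L nat).

HB.instance Definition _ :=
  Topological.copy (aut M) (initial_topology (@aut_ptws L M)).

Let aut_eval_nbhs (g : aut M) (n : nat) : nbhs g [set h : aut M | h n = g n].
Proof.
have cf : continuous (@aut_ptws L M) := @initial_continuous _ _ (@aut_ptws L M).
have cp := @proj_continuous nat (fun=> nat) n.
exact: (continuous_comp (cf g) (cp (aut_ptws g))) (discrete_set1 (g n)).
Qed.

Let aut_continuous (X : topologicalType) (f : X -> aut M) :
  (forall (x : X) (n : nat), nbhs x [set y | f y n = f x n]) -> continuous f.
Proof.
move=> fP; apply: (@continuous_comp_initial _ X _ (@aut_ptws L M) f) => x.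
apply/cvg_sup => n A; rewrite nbhsE => -[B [[C _ <-] Cx] BA].
by apply: filterS (fP x n) => y fy; apply: BA; rewrite /= [aut_ptws _ _]fy.
Qed.

Let autM_continuous : continuous (fun p : aut M * aut M => (p.1 * p.2)%g).
Proof.
apply: aut_continuous => -[g h] n.
exists ([set g' : aut M | g' (h n) = g (h n)], [set h' : aut M | h' n = h n]).
  by split; exact: aut_eval_nbhs.
by move=> [g' h'] /= [gg' hh']; rewrite hh' gg'.
Qed.

Let autV_continuous : continuous (fun g : aut M => (g^-1)%g).
Proof.
apply: aut_continuous => g n.
apply: filterS (aut_eval_nbhs g (aut_inv g n)) => h /= hg.
by rewrite -[RHS](aut_invK h) hg aut_invVK.
Qed.

HB.instance Definition _ :=
  isTopologicalGroup.Build (aut M) autM_continuous autV_continuous.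

End AutTopology.

(* Aut(Fs) as a subset of Aut(F); every automorphism of Fs occurs in it when
   [reduct Fs = F]. *)
Definition aut_of_expansion (L : signature) (I : countType) (alpha : I -> nat)
    (T : Type) (F : structure L T) (Fs : structure (expand L alpha) T) :
    set (aut F) :=
  [set g | exists h : aut Fs, (h : T -> T) = g].
Arguments aut_of_expansion {L I alpha T} F Fs _.

(* Main.v *)
Require Import Defs.
From HB Require Import structures.
From mathcomp Require Import all_boot.
From mathcomp Require Import boolp classical_sets functions cardinality filter.
From mathcomp Require Import topology.

(** Write [G = Aut F] and [Gs = Aut Fs], where [F] is the reduct of [Fs].  By
    ultrahomogeneity, two embeddings of a finite structure into [F] differ by
    an element of [G] ([ultrahomogeneous_emb]), and they differ by an element of
    [Gs] if they induce the same canonical expansion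
    ([canonical_expansion_orbit]).

    Amenability implies the Ramsey property.  Fix [A] and [Bs].  Call a
    colouring of the embeddings of [A] in [F] canonical on an embedding [b] of
    the reduct of [Bs] if the colour of [b a] depends only on the canonical
    expansion induced by [a].  The colourings that are canonical on no [b] form
    a closed [G]-invariant subset of the compact space of all colourings.  If
    this subset were nonempty it would contain a colouring fixed by [Gs]; but a
    colouring fixed by [Gs] is canonical on every [b] that embeds [Bs] in [Fs]
    ([amenable_canonical_on]).  So every colouring is canonical on some [b],
    and since being canonical on a given [b] depends on finitely many colours,
    compactness of the space of colourings yields one finite structure [C] that
    works for all colourings ([canonical_on_compactness]).

    The Ramsey property implies amenability ([relative_ramsey_amenable]).  If
    [G] acts on a compact Hausdorff space [X] without a point fixed by [Gs],
    then every point [x] has a neighbourhood [N] and some [h] in [Gs] such that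
    no [y] has both [y] and [h^-1 y] moved into [N] by elements of [G] close to
    the identity.  Finitely many such [N] cover [X]; closeness to the identity
    is then measured on one finite substructure [A].  Fix [x0] in [X], and
    colour the restriction of [g] to [A] by the index of an [N] that contains
    [g^-1 x0] (for one chosen extension [g] of each embedding).  The Ramsey
    property gives a [g] for which the embeddings [g] and [g h] of [A] have the
    same colour, for all the finitely many [h] at once; then [y = g^-1 x0]
    contradicts the choice of the [N] of that colour.

    Rigidity is a consequence of the Ramsey property
    ([relative_ramsey_rigid]): for an automorphism [g] of a finite [As] and a
    point [x] with [g x <> x], order the target structure linearly and colour an
    embedding [a] by whether [a x < a (g x)].  If the embeddings [b g^j] all
    have the same colour, then the sequence [b (g^j x)] is strictly monotone,
    which is impossible since [As] is finite. *)

Set Implicit Arguments.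
Unset Strict Implicit.
Unset Printing Implicit Defensive.

Local Open Scope classical_set_scope.

(** * Finite types *)

Lemma finite_setT_injP (T : Type) :
  finite_set [set: T] <-> exists (J : finType) (f : T -> J), injective f.
Proof.
split.
  elim/Ppointed: T => T.
    by move=> _; exists unit, (fun x => False_rect _ (no x)) => x; case: (no x).
  case=> n; rewrite card_eq_sym => /card_set_bijP[f [_ finj fsurj]].
  have fP (x : T) : exists i : 'I_n, f i = x.
    by have [i /= ilt <-] := fsurj x I; exists (Ordinal ilt).
  have [h hP] := choice fP; exists 'I_n, h => x y hxy.
  by rewrite -(hP x) hxy hP.
move=> [J [f finj]].
have -> : [set: T] = f @^-1` [set: J] by [].
by apply: finite_preimage => // x y _ _; exact: finj.
Qed.

Lemma near_forall_finite (T U : Type) (P : T -> set U) (F : set_system U) :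
  Filter F -> finite_set [set: T] -> (forall t, F (P t)) ->
  F [set u | forall t, P t u].
Proof.
move=> FF /finite_setT_injP[J [f finj]] FP.
have : F [set u | forall j : J, forall t, f t = j -> P t u].
  apply: filter_forall => j.
  have [[t ft]|nj] := pselect (exists t, f t = j).
    by apply: filterS (FP t) => u Pu t'; rewrite -ft => /finj ->.
  by apply: nearW => u t ft; case: nj; exists t.
by apply: filterS => u Pu t; exact: Pu.
Qed.

(** * Embeddings, substructures and homogeneity *)

Section Embeddings.
Context (L : signature).

Lemma finite_embedding (TA TB : Type) (A : structure L TA)
    (B : structure L TB) :
  finite_set [set: TA] -> finite_set [set: TB] ->
  finite_set [set: embedding A B].
Proof.
move=> /finite_setT_injP[I [f finj]] /finite_setT_injP[J [g ginj]].
apply/finite_setT_injP.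
(* An embedding is determined by its graph, a subset of the finite [I * J]. *)
pose gr (e : embedding A B) : {set I * J} :=
  finset (fun p => `[< exists x, p = (f x, g (e x)) >]).
exists {set I * J}, gr => e e' grE; apply: emb_ext => x.
have : (f x, g (e x)) \in gr e by rewrite inE; apply/asboolP; exists x.
rewrite grE inE => /asboolP[y [fxy gexy]].
by rewrite (ginj _ _ gexy) -(finj _ _ fxy).
Qed.

(** The inclusion of a substructure. *)
Definition sub_emb (T : Type) (M : structure L T) (X : set T)
    (hX : closed_under M X) : embedding (substructure hX) M :=
  @Embedding L X T (substructure hX) M val val_inj
    (fun _ _ => erefl) (fun _ _ => iff_refl _).

Lemma emb_corestrict (TA T : Type) (A : structure L TA) (M : structure L T)
    (X : set T) (hX : closed_under M X) (e : embedding A M) :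
  (forall x, X (e x)) ->
  exists e' : embedding A (substructure hX), forall x, val (e' x) = e x.
Proof.
move=> eX; pose f x : X := exist _ (e x) (mem_set (eX x)).
have finj : injective f by move=> x y [exy]; exact: (emb_inj exy).
have ffun (s : funsym L) (x : 'I_(funsym_arity s) -> TA) :
    f (funI A s x) = funI (substructure hX) s (f \o x).
  by apply: val_inj; rewrite /= emb_funI.
have frel (r : relsym L) (x : 'I_(relsym_arity r) -> TA) :
    relI A r x <-> relI (substructure hX) r (f \o x).
  by rewrite (emb_relI e).
by exists (Embedding finj ffun frel).
Qed.

Lemma range_closed (TA T : Type) (A : structure L TA) (M : structure L T)
  (a : embedding A M) : closed_under M (range a).
Proof.
move=> f x xr; have /choice[y yP] : forall i, exists y, a y = x i.
  by move=> i; have [y _ <-] := xr i; exists y.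
exists (funI A f y) => //; rewrite emb_funI.
by congr (funI M f _); apply/funext.
Qed.

Arguments range_closed {TA T A M} a.

Lemma iso_range (TA T : Type) (A : structure L TA) (M : structure L T)
    (a : embedding A M) :
  exists i : iso A (substructure (range_closed a)),
    forall x, val (i x) = a x.
Proof.
have [e eP] := @emb_corestrict _ _ _ _ _ (range_closed a) a (imageT a).
have eb : bijective e.
  have /choice[h hP] : forall y : range a, exists x, a x = val y.
    by move=> [y /= /[dup] yr /set_mem[x _ <-]]; exists x.
  exists h => [x|y]; first by apply: (@emb_inj _ _ _ _ _ a); rewrite hP eP.
  by apply: val_inj; rewrite eP hP.
by exists (Iso eb).
Qed.

Lemma iso_sym (TA TB : Type) (A : structure L TA) (B : structure L TB)
    (f : iso A B) :
  exists g : iso B A, cancel f g /\ cancel g f.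
Proof.
have [g fK gK] := iso_bij f.
have gfun (s : funsym L) (x : 'I_(funsym_arity s) -> TB) :
    g (funI B s x) = funI A s (g \o x).
  apply: (@emb_inj _ _ _ _ _ f); rewrite gK emb_funI.
  by congr (funI B s _); apply/funext => i /=; rewrite gK.
have grel (r : relsym L) (x : 'I_(relsym_arity r) -> TB) :
    relI B r x <-> relI A r (g \o x).
  rewrite (emb_relI f); suff -> : f \o (g \o x) = x by [].
  by apply/funext => i /=; rewrite gK.
by exists (@Iso _ _ _ B A (Embedding (can_inj gK) gfun grel) (Bijective gK fK)).
Qed.

(** Homogeneity in terms of embeddings: the isomorphism [a x |-> a' x] between
    the ranges extends to an automorphism. *)
Lemma ultrahomogeneous_emb (TA T : Type) (A : structure L TA)
    (M : structure L T) (a a' : embedding A M) :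
  ultrahomogeneous M -> finite_set [set: TA] ->
  exists g : aut M, forall x, g (a x) = a' x.
Proof.
move=> homM finA; have [i iP] := iso_range a; have [i' i'P] := iso_range a'.
have [j [ijK jiK]] := iso_sym i.
have fin (b : embedding A M) : finite_set (range b) by exact: finite_image.
have [g gP] := homM _ _ _ _ (fin a) (fin a') (iso_comp i' j).
by exists g => x; rewrite -iP gP /= ijK i'P.
Qed.

Lemma closed_generated (T : Type) (M : structure L T) (X : set T) :
  closed_under M (generated M X).
Proof.
move=> f x xG Y [hY XY]; apply: (hY) => i; exact: xG.
Qed.

Lemma finite_set_type (T : Type) (X : set T) :
  finite_set X -> finite_set [set: X].
Proof.
move=> finX; have -> : [set: X] = val @^-1` X.
  by apply/seteqP; split=> // x _; exact: set_mem (valP x).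
by apply: finite_preimage => // x y _ _; exact: val_inj.
Qed.

Lemma Age_sub (T : Type) (M : structure L T) (X : set T)
  (hX : closed_under M X) : finite_set X -> Age M (substructure hX).
Proof.
by move=> /finite_set_type finX; split=> //; constructor; exact: sub_emb.
Qed.

End Embeddings.

Arguments sub_emb {L T M X} hX.
Arguments closed_generated {L T} M X.

(** * Reducts and canonical expansions *)

Section Reducts.
Context (L : signature) (I : countType) (alpha : I -> nat).
Local Notation Ls := (expand L alpha).

(** The same map, between the reducts. *)
Definition emb_reduct (TA TB : Type) (As : structure Ls TA)
    (Bs : structure Ls TB) (e : embedding As Bs) :
    embedding (reduct As) (reduct Bs) :=
  @Embedding L TA TB (reduct As) (reduct Bs) e (@emb_inj _ _ _ _ _ e)
    (@emb_funI _ _ _ _ _ e) (fun r => @emb_relI _ _ _ _ _ e (inl r)).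

Definition aut_reduct (T : Type) (Ms : structure Ls T) (g : aut Ms) :
    aut (reduct Ms) :=
  @Iso L T T (reduct Ms) (reduct Ms) (emb_reduct g) (iso_bij g).

Lemma canonical_expansion_reduct (TA TB : Type) (As : structure Ls TA)
    (Bs : structure Ls TB) (e : embedding As Bs) :
  canonical_expansion (emb_reduct e) = As.
Proof.
have relE : (@relI Ls _ (canonical_expansion (emb_reduct e))) = @relI Ls _ As.
  apply: functional_extensionality_dep => -[r //|i].
  apply/funext => x; apply/propext.
  exact: iff_sym (@emb_relI _ _ _ _ _ e (inr i) x).
by case: As e relE => fA rA e /= relE; rewrite /canonical_expansion /= relE.
Qed.

(** An embedding in a reduct embeds the canonical expansion that it induces. *)
Lemma canonical_emb (TA TB : Type) (A : structure L TA)
    (Bs : structure Ls TB) (a : embedding A (reduct Bs)) :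
  exists e : embedding (canonical_expansion a) Bs, (e : TA -> TB) = a.
Proof.
have rel (r : relsym Ls) (x : 'I_(relsym_arity r) -> TA) :
    relI (canonical_expansion a) r x <-> relI Bs r (a \o x).
  case: r x => [r|i] x //; exact: (emb_relI a).
by exists (@Embedding Ls TA TB (canonical_expansion a) Bs a
  (@emb_inj _ _ _ _ _ a) (@emb_funI _ _ _ _ _ a) rel).
Qed.

(** Embeddings that induce the same canonical expansion lie in one orbit of
    [Aut Ms] after composition with [b]: both embed that common expansion. *)
Lemma canonical_expansion_orbit (TA TB T : Type) (A : structure L TA)
    (Bs : structure Ls TB) (Ms : structure Ls T) (b : embedding Bs Ms)
    (a0 a1 : embedding A (reduct Bs)) :
  ultrahomogeneous Ms -> finite_set [set: TA] ->
  canonical_expansion a0 = canonical_expansion a1 ->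
  exists g : aut Ms, forall x, g (b (a0 x)) = b (a1 x).
Proof.
move=> homM finA a01.
have [e0 e0E] := canonical_emb a0.
have [e1 e1E] : exists e1 : embedding (canonical_expansion a0) Bs,
    (e1 : TA -> TB) = a1 by rewrite a01; exact: canonical_emb.
have [g gP] := ultrahomogeneous_emb (emb_comp b e0) (emb_comp b e1) homM finA.
by exists g => x; have := gP x; rewrite /= e0E e1E.
Qed.

Lemma Age_reduct (TA T : Type) (As : structure Ls TA) (Ms : structure Ls T) :
  Age Ms As -> Age (reduct Ms) (reduct As).
Proof. by move=> [fin [e]]; split=> //; constructor; exact: emb_reduct. Qed.

End Reducts.

(** * Compactness, subspaces and pointwise convergence *)

(** Every choice of neighbourhoods of the points of a compact space has a finite
    subcover. *)
Lemma compact_nbhs_cover (X : topologicalType) (N : X -> set X) :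
  compact [set: X] -> (forall x, nbhs x (N x)) ->
  exists s : seq X, forall y, exists2 x, x \in s & N x y.
Proof.
move=> /compact_near_coveringP cX Nx.
(* The filter of properties that hold for all large enough finite families. *)
pose F := [set S : set (seq X) |
  exists s0 : seq X, forall s, {subset s0 <= s} -> S s].
have FF : Filter F.
  split.
  - by exists [::].
  - move=> P Q [p pP] [q qQ]; exists (p ++ q) => s sub; split.
      by apply: pP => z zp; apply: sub; rewrite mem_cat zp.
    by apply: qQ => z zq; apply: sub; rewrite mem_cat zq orbT.
  - by move=> P Q PQ [p pP]; exists p => s /pP /PQ.
have [|s sP] := cX _ F (fun s y => exists2 x, x \in s & N x y) FF.
  move=> x _; exists (N x, [set s | x \in s]) => /=.
    by split=> //; exists [:: x] => s; apply; rewrite inE.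
  by move=> [y s] /= [Ny xs]; exists x.
by exists s => y; exact: (sP s).
Qed.

Lemma hausdorff_set_type (X : topologicalType) (D : set X) :
  hausdorff_space X -> hausdorff_space D.
Proof.
move=> hX p q clpq; apply: val_inj; apply: hX => U V Up Vq.
have vc := @initial_continuous D X set_val.
by have [z [Uz Vz]] := clpq _ _ (vc p _ Up) (vc q _ Vq); exists (val z).
Qed.

Lemma compact_set_type (X : topologicalType) (D : set X) :
  compact D -> compact [set: D].
Proof.
move=> cD F PF _.
have [|p [Dp clp]] := cD (val @ F) (fmap_proper_filter _ PF).
  by apply: nearW => x; exact: set_mem (valP x).
exists (exist _ p (mem_set Dp)); split=> // U V FU.
move=> [W [[O oO <-] Op] OV].
have FU' : (val @ F) (val @` U).
  by apply: (@filterS _ F _ U) => // x Ux; exists x.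
have [_ [[x Ux <-] Ox]] := clp _ _ FU' (open_nbhs_nbhs (conj oO Op)).
by exists x; split=> //; exact: OV.
Qed.

Section AutNbhs.
Context (L : signature) (M : structure L nat).

Lemma aut_eval_nbhs (g : aut M) (n : nat) : nbhs g [set h : aut M | h n = g n].
Proof.
have cf : continuous (@aut_ptws L M) := @initial_continuous _ _ (@aut_ptws L M).
have cp := @proj_continuous nat (fun=> nat) n.
exact: (continuous_comp (cf g) (cp (aut_ptws g))) (discrete_set1 (g n)).
Qed.

(** Every neighbourhood of the identity contains the pointwise stabiliser of an
    initial segment of [nat]. *)
Lemma aut_nbhs1_fix (V : set (aut M)) : nbhs (1%g : aut M) V ->
  exists n, forall g : aut M, (forall i, i < n -> g i = i) -> V g.
Proof.
pose F := [set S : set (aut M) |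
  exists n, forall g : aut M, (forall i, i < n -> g i = i) -> S g].
have FF : Filter F.
  split.
  - by exists 0.
  - move=> P Q [p pP] [q qQ]; exists (maxn p q) => g gfix; split.
      by apply: pP => i ip; apply: gfix; rewrite leq_max ip.
    by apply: qQ => i iq; apply: gfix; rewrite leq_max iq orbT.
  - by move=> P Q PQ [p pP]; exists p => g /pP /PQ.
have Fcvg : fmap (@aut_ptws L M) F --> aut_ptws (1%g : aut M).
  apply/cvg_sup => n S; rewrite nbhsE => -[B [[C _ <-] C1] BS].
  exists n.+1 => g gfix; apply: BS => /=.
  by rewrite /aut_ptws gfix.
move=> [W [[O oO <-] O1] OV].
have [n nP] := Fcvg _ (open_nbhs_nbhs (conj oO O1)).
by exists n => g /nP /OV.
Qed.

End AutNbhs.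

Lemma continuous_ptws_discrete (Y : topologicalType) (J : Type)
    (T : choiceType) (D : set {ptws J -> discrete_topology T}) (f : Y -> D) :
  (forall y j, nbhs y [set z | val (f z) j = val (f y) j]) -> continuous f.
Proof.
move=> fP; apply: (@continuous_comp_initial _ _ _ set_val) => y.
apply/cvg_sup => j S; rewrite nbhsE => -[B [[C _ <-] Cx] BS].
apply: filterS (fP y j) => z zy; apply: BS.
have : C (val (f y) j) by exact: Cx.
by rewrite -zy.
Qed.

Lemma ptws_discrete_nbhs (J : Type) (T : choiceType)
    (c : {ptws J -> discrete_topology T}) (j : J) :
  nbhs c [set d : {ptws J -> discrete_topology T} | d j = c j].
Proof.
have cj := @proj_continuous {classic J} (fun=> discrete_topology T) j c.
exact: cj _ (discrete_set1 (c j : discrete_topology T)).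
Qed.

(** * Consequences of the relative Ramsey property *)

Section RelativeRamsey.
Context (L : signature) (I : countType) (alpha : I -> nat).
Local Notation Ls := (expand L alpha).
Context (Fs : structure Ls nat).
Local Notation F := (reduct Fs).

Lemma relative_ramsey_rigid (TA : Type) (As : structure Ls TA) :
  relative_ramsey_emb (Age F) (Age Fs) -> Age Fs As -> rigid As.
Proof.
move=> RR AgeAs g x; apply: contrapT => gx.
have [TC [C [[_ [e]] CP]]] :=
  RR 2 _ (reduct As) _ As (Age_reduct AgeAs) AgeAs.
(* [C] is ordered through its embedding [e] in [nat]. *)
pose c (a : embedding (reduct As) C) : 'I_2 :=
  if e (a x) < e (a (g x)) then ord0 else ord_max.
have [b bP] := CP c.
pose u j := e (b ((g ^+ j)%g x)).
(* The power [g ^+ j] maps [x, g x] to [g ^+ j x, g ^+ j.+1 x], and all powers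
   of [g] induce the same canonical expansion [As]. *)
have uS j : (u j < u j.+1) = (u 0 < u 1).
  have := bP (emb_reduct (g ^+ j)%g) (emb_reduct (g ^+ 0)%g).
  rewrite !canonical_expansion_reduct => /(_ erefl); rewrite /c /=.
  have -> : (g ^+ j)%g (g x) = (g ^+ j.+1)%g x by rewrite expgSr.
  by rewrite /u expg1; do 2!case: ltnP => _ // /(congr1 val).
have uN j : u j != u j.+1.
  apply/eqP; rewrite /u expgSr => E; apply: gx.
  exact: esym (emb_inj (emb_inj (emb_inj E))).
have uinj : injective u.
  have [u01|u10] := boolP (u 0 < u 1).
    have ulti : {homo u : i j / i < j}.
      by apply: (homo_ltn ltn_trans) => j; rewrite uS.
    by move=> i j uij; case: (ltngtP i j) => // /ulti; rewrite uij ltnn.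
  have ugt : {homo u : i j / i < j >-> j < i}.
    apply: (homo_ltn (fun y x z xy yz => ltn_trans yz xy)) => j.
    by rewrite ltn_neqAle eq_sym uN leqNgt uS.
  by move=> i j uij; case: (ltngtP i j) => // /ugt; rewrite uij ltnn.
apply: infinite_nat; have -> : [set: nat] = (fun j => (g ^+ j)%g x) @^-1` setT.
  by [].
apply: finite_preimage; last by case: AgeAs.
by move=> i j _ _ gij; apply: uinj; rewrite /u gij.
Qed.

Lemma relative_ramsey_amenable :
  locally_finite Fs -> ultrahomogeneous F ->
  relative_ramsey_emb (Age F) (Age Fs) ->
  relatively_extremely_amenable (aut_of_expansion F Fs).
Proof.
move=> lfF homF RR X act hX cX [x0 _] [act1 actM actC].
apply: contrapT => nofix.
have moved x : exists h : aut Fs, act (aut_reduct h)^-1%g x <> x.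
  apply: contrapT => /forallNP fixed; apply: nofix; exists x => g [h hg].
  have -> : g = aut_reduct h by apply: iso_ext => y; rewrite -hg.
  by rewrite -[in LHS](contrapT (fixed h)) -actM mulgV act1.
(* [d] packs the element of [Gs], the size of the initial segment that measures
   closeness to the identity, and the neighbourhood of [x]. *)
have local (x : X) : exists d : (aut Fs * nat) * set X, nbhs x d.2 /\
    forall (y : X) (s s' : aut F),
      (forall i, i < d.1.2 -> s i = i) -> (forall i, i < d.1.2 -> s' i = i) ->
      d.2 (act s y) -> d.2 (act s' (act (aut_reduct d.1.1)^-1%g y)) -> False.
  have [h /eqP hx] := moved x.
  move: hX; rewrite open_hausdorff => /(_ _ _ hx)[[A B] /= [hxA xB]].
  move: hxA xB => /set_mem hxA /set_mem xB [oA oB /eqP AB0].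
  have [[P Q] /= [Ph Qx] PQ] := actC ((aut_reduct h)^-1%g, x) A
    (open_nbhs_nbhs (conj oA hxA)).
  (* [h^-1] maps [B `&` Q] into [A], which is disjoint from [B]; elements close
     to the identity map [N] into [B `&` Q]. *)
  have W1x : nbhs (act 1%g x) (B `&` Q).
    by rewrite act1; apply: filterI => //; exact: open_nbhs_nbhs.
  have [[P1 N] /= [P11 Nx] PN] := actC (1%g, x) _ W1x.
  have [n nP1] := aut_nbhs1_fix P11.
  have NW y (s : aut F) : (forall i, i < n -> s i = i) -> N (act s y) ->
      (B `&` Q) y.
    move=> sfix Nsy; rewrite -(act1 y) -(mulVg s) actM.
    apply: (PN (s^-1%g, act s y)); split=> //=; apply: nP1 => i i_n.
    by rewrite -[in LHS](sfix i i_n); exact: aut_invK.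
  exists (h, n, N); split=> //= y s s' sfix s'fix /(NW _ _ sfix)[_ Qy].
  move=> /(NW _ _ s'fix)[Bhy _].
  have Ahy : A (act (aut_reduct h)^-1%g y).
    by apply: (PQ ((aut_reduct h)^-1%g, y)); split=> //=; exact: nbhs_singleton.
  by have : (A `&` B) (act (aut_reduct h)^-1%g y) by []; rewrite AB0.
have {local}[d dP] := choice local.
have [s sP] := compact_nbhs_cover cX (fun x => (dP x).1).
pose h x := (d x).1.1; pose N x := (d x).2.
pose n := \max_(x <- s) (d x).1.2.
have dn x i : x \in s -> i < (d x).1.2 -> i < n.
  by move=> xs /leq_trans; apply; apply: leq_bigmax_seq.
have hX0 := closed_generated Fs `I_n; have X0fin := lfF _ (finite_II n).
set X0 := generated Fs `I_n in hX0 X0fin.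
have X0n i : i < n -> X0 i by move=> lt_in; exact: sub_gen_smallest.
(* [Bs] has to contain [X0] and its images under the finitely many [h x]. *)
pose S0 := X0 `|` \bigcup_(x in [set` s]) (h x @` X0).
have S0fin : finite_set S0.
  rewrite finite_setU; split=> //; apply: bigcup_finite.
    exact: finite_seq.
  by move=> x _; exact: finite_image.
have hY := closed_generated Fs S0; have Yfin := lfF _ S0fin.
set Y := generated Fs S0 in hY Yfin.
have SY : S0 `<=` Y by exact: sub_gen_smallest.
pose As := substructure hX0; pose Bs := substructure hY.
(* A colour of [a] is an index of a neighbourhood that contains [g^-1 x0], where
   [g] is some extension of [a]. *)
have col (a : embedding (reduct As) F) : exists j : 'I_(size s),
    exists2 g : aut F, forall x, g (val x) = a x &
      N (nth x0 s j) (act g^-1%g x0).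
  have [g gP] := ultrahomogeneous_emb (emb_reduct (sub_emb hX0)) a homF
    (finite_set_type X0fin).
  have [x xs Nx] := sP (act g^-1%g x0).
  have lt_j : index x s < size s by rewrite index_mem.
  by exists (Ordinal lt_j), g => //=; rewrite nth_index.
have [c cP] := choice col.
have AgeA := Age_sub hX0 X0fin; have AgeB := Age_sub hY Yfin.
have [TC [C [[_ [e]] CP]]] := RR (size s) _ _ _ Bs (Age_reduct AgeA) AgeB.
have [b bP] := CP (fun a => c (emb_comp e a)).
have [g gP] := ultrahomogeneous_emb (emb_reduct (sub_emb hY)) (emb_comp e b)
  homF (finite_set_type Yfin).
have {}gP y : e (b y) = g (val y) := esym (gP y).
(* [a0] is the inclusion of [X0] in [Y], and [a1] the restriction to [X0] of the
   [h x] attached to the colour of [g a0]. *)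
have [a0 a0P] := @emb_corestrict _ _ _ _ _ _ hY (sub_emb hX0)
  (fun x => SY _ (or_introl (set_mem (valP x)))).
set E0 := emb_comp e (emb_comp b (emb_reduct a0)).
have [g1 g1P Ng1] := cP E0.
set x := nth x0 s (c E0) in Ng1.
have xs : x \in s by exact: mem_nth.
have hYx : forall z, Y (emb_comp (h x) (sub_emb hX0) z).
  move=> z; apply: SY; right; exists x => //; exists (val z) => //.
  exact: set_mem (valP z).
have [a1 a1P] := @emb_corestrict _ _ _ _ _ _ hY _ hYx.
have := cP (emb_comp e (emb_comp b (emb_reduct a1))).
rewrite -(bP (emb_reduct a0) (emb_reduct a1)); last first.
  by rewrite !canonical_expansion_reduct.
move=> [g2 g2P Ng2].
have g1E i : X0 i -> g1 i = g i.
  move=> X0i; have := g1P (exist _ i (mem_set X0i)).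
  by rewrite /= gP a0P.
have g2E i : X0 i -> g2 i = g (h x i).
  move=> X0i; have := g2P (exist _ i (mem_set X0i)).
  by rewrite /= gP a1P.
(* [g1^-1 g] and [g2^-1 g h] fix [X0] pointwise. *)
apply: ((dP x).2 (act g^-1%g x0) (g1^-1 * g)%g
  (g2^-1 * (g * aut_reduct (h x)))%g).
- by move=> i /(dn _ _ xs)/X0n/g1E gi; rewrite /= -gi; exact: aut_invK.
- by move=> i /(dn _ _ xs)/X0n/g2E gi; rewrite /= -gi; exact: aut_invK.
- by rewrite -actM -mulgA mulgV mulg1.
- by rewrite -!actM -!mulgA (mulgA (aut_reduct _)) mulgV mul1g mulgV mulg1.
Qed.

End RelativeRamsey.

(** * Consequences of relative extreme amenability *)

(* Tychonoff's theorem asks for an index type with a boolean equality. *)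
HB.instance Definition _ (L : signature) (TA TB : Type) (A : structure L TA)
  (B : structure L TB) := gen_eqMixin (embedding A B).

Section RelativeAmenability.
Context (L : signature) (I : countType) (alpha : I -> nat).
Local Notation Ls := (expand L alpha).
Context (Fs : structure Ls nat).
Local Notation F := (reduct Fs).

Section OneColoring.
Context (TA TB : Type) (A : structure L TA) (Bs : structure Ls TB) (k : nat).

(** The colouring [c] is canonical on the copy [b] of the reduct of [Bs]: on that
    copy, the colour depends only on the induced canonical expansion of [A]. *)
Definition canonical_on (TC : Type) (C : structure L TC)
    (c : embedding A C -> 'I_k) (b : embedding (reduct Bs) C) : Prop :=
  forall a0 a1 : embedding A (reduct Bs),
    canonical_expansion a0 = canonical_expansion a1 ->
    c (emb_comp b a0) = c (emb_comp b a1).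

Local Notation colorings :=
  {ptws embedding A F -> discrete_topology 'I_k}.

(** Only finitely many embeddings of [A] factor through [b], so the colourings
    that agree with [c] on them form a neighbourhood of [c]. *)
Lemma nbhs_coloring_on (b : embedding (reduct Bs) F) (c : colorings) :
  finite_set [set: TA] -> finite_set [set: TB] ->
  nbhs c [set c' : colorings |
    forall a : embedding A (reduct Bs), c' (emb_comp b a) = c (emb_comp b a)].
Proof.
move=> finA finB; apply: near_forall_finite => [|a].
  exact: finite_embedding.
exact: ptws_discrete_nbhs.
Qed.

Lemma colorings_compact : compact [set: colorings].
Proof.
have := @tychonoff (embedding A F) (fun=> discrete_topology 'I_k)
  (fun=> setT)
  (fun=> @finite_compact (discrete_topology 'I_k) _ (@finite_finset 'I_k _)).
by congr compact; apply/seteqP; split.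
Qed.

Lemma colorings_hausdorff : hausdorff_space colorings.
Proof.
exact: (@hausdorff_product (embedding A F) (fun=> discrete_topology 'I_k)
  (fun=> discrete_hausdorff)).
Qed.

(** The colourings that are canonical on no copy of the reduct of [Bs] form a
    [G]-flow without a [Gs]-fixed point, so there are none. *)
Lemma amenable_canonical_on (c0 : embedding A F -> 'I_k) :
  relatively_extremely_amenable (aut_of_expansion F Fs) ->
  ultrahomogeneous Fs -> finite_set [set: TA] -> Age Fs Bs ->
  exists b : embedding (reduct Bs) F, canonical_on c0 b.
Proof.
move=> amen homF finA [finB [bs]]; apply: contrapT => bad0.
pose D : set colorings := [set c | forall b, ~ canonical_on c b].
have D0 : D c0 by move=> b cb; apply: bad0; exists b.
have cD : compact D.
  apply: (subclosed_compact _ colorings_compact) => // c Dc.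
  move=> b cb; have [c' [Dc' cc']] := Dc _ (nbhs_coloring_on b c finA finB).
  by apply: (Dc' b) => a0 a1 /cb; rewrite !cc'.
pose shift (g : aut F) (c : colorings) : colorings :=
  fun a => c (emb_comp (g^-1)%g a).
have shiftD g c : D c -> D (shift g c).
  move=> Dc b cb; apply: (Dc (emb_comp (g^-1)%g b)) => a0 a1 /cb.
  have E a : emb_comp (emb_comp g^-1%g b) a = emb_comp g^-1%g (emb_comp b a).
    exact: emb_ext.
  by rewrite !E.
pose act (g : aut F) (c : D) : D :=
  exist _ (shift g (val c)) (mem_set (shiftD g _ (set_mem (valP c)))).
have act_cont : is_continuous_action act.
  split.
  - move=> c; apply: val_inj; apply/funext => a.
    change (val c (emb_comp ((1%g : aut F)^-1%g : aut F) a) = val c a).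
    by rewrite invg1; congr (val c _); exact: emb_ext.
  - move=> g h c; apply: val_inj; apply/funext => a.
    change (val c (emb_comp ((g * h)^-1%g : aut F) a) =
            val c (emb_comp (h^-1%g : aut F) (emb_comp (g^-1%g : aut F) a))).
    by rewrite invgM; congr (val c _); exact: emb_ext.
  apply: continuous_ptws_discrete => -[g c] a.
  exists ([set g' : aut F | forall x, (g'^-1)%g (a x) = (g^-1)%g (a x)],
          [set c' : D | val c' (emb_comp (g^-1)%g a) =
                        val c (emb_comp (g^-1)%g a)]).
    split=> /=.
      apply: near_forall_finite => // x.
      exact: (@invg_continuous (aut F) g) (aut_eval_nbhs (g^-1)%g (a x)).
    have vc := @initial_continuous D colorings set_val.
    exact: (vc c) (ptws_discrete_nbhs (val c) _).
  move=> [g' c'] /= [gg' cc']; rewrite /shift -cc'; congr (val c' _).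
  by apply: emb_ext => x /=.
have [c cfix] := amen D act (hausdorff_set_type colorings_hausdorff)
  (compact_set_type cD) (ex_intro _ (exist _ c0 (mem_set D0)) Logic.I) act_cont.
(* The fixed colouring [c] is canonical on the copy [bs] of [Bs] in [Fs]. *)
apply: (set_mem (valP c) (emb_reduct bs)) => a0 a1 a01.
have [g gP] := canonical_expansion_orbit bs homF finA a01.
rewrite -[in RHS](cfix (aut_reduct g)) /=; last by exists g.
rewrite /shift; congr (val c _); apply: emb_ext => x /=.
by rewrite -gP; apply/esym; exact: (aut_invK (aut_reduct g)).
Qed.

(** From colourings of the embeddings in [F] to colourings of the embeddings in
    one finite structure. *)
Lemma canonical_on_compactness :
  locally_finite F -> Age F A -> Age F (reduct Bs) ->
  (forall c : embedding A F -> 'I_k,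
     exists b : embedding (reduct Bs) F, canonical_on c b) ->
  exists (TC : Type) (C : structure L TC), Age F C /\
    forall c : embedding A C -> 'I_k,
    exists b : embedding (reduct Bs) C, canonical_on c b.
Proof.
move=> lfF [finA _] AgeB allc; have finB := AgeB.1.
(* Without colours, the reduct of [Bs] itself will do: a colouring of the
   embeddings in it exists only if there are no embeddings. *)
have [k0|k0] := posnP k.
  exists TB, (reduct Bs); split=> // c; exists (emb_id _) => a0 a1 _.
  by case: (c _) => i lt_ik; have := lt_ik; rewrite {1}k0.
have [d dP] := choice allc.
have [s sP] := compact_nbhs_cover colorings_compact
  (fun c => nbhs_coloring_on (d c) c finA finB).
pose S := \bigcup_(c in [set` s]) range (d c).
have Sfin : finite_set S.
  by apply: bigcup_finite => [|c _]; [exact: finite_seq|exact: finite_image].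
have hZ := closed_generated F S; have Zfin := lfF _ Sfin.
exists (generated F S), (substructure hZ); split; first exact: Age_sub.
move=> c.
(* Extend [c] to the embeddings in [F], with a default colour. *)
have [c' c'P] : exists c' : colorings, forall a : embedding A (substructure hZ),
    c' (emb_comp (sub_emb hZ) a) = c a.
  have /choice[c' c'P] : forall a' : embedding A F, exists i : 'I_k,
      forall a, emb_comp (sub_emb hZ) a = a' -> i = c a.
    move=> a'; have [[a aa']|no] :=
        pselect (exists a, emb_comp (sub_emb hZ) a = a').
      exists (c a) => a2; rewrite -aa' => a2a; congr c; apply: emb_ext => x.
      have := congr1 (fun e : embedding A F => e x) a2a.
      by move=> /= /val_inj.
    by exists (Ordinal k0) => a aa'; case: no; exists a.
  by exists c' => a; exact: c'P.
have [c1 c1s cc1] := sP c'.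
have [b bP] := @emb_corestrict _ _ _ _ _ _ hZ (d c1)
  (fun x => sub_gen_smallest (ex_intro2 _ _ c1 c1s (imageT (d c1) x))).
exists b => a0 a1 /(dP c1).
have E a : emb_comp (sub_emb hZ) (emb_comp b a) = emb_comp (d c1) a.
  by apply: emb_ext => x /=; exact: bP.
by rewrite -!cc1 -!E !c'P.
Qed.

End OneColoring.

Lemma amenable_relative_ramsey :
  relatively_extremely_amenable (aut_of_expansion F Fs) ->
  locally_finite F -> ultrahomogeneous Fs ->
  relative_ramsey_emb (Age F) (Age Fs).
Proof.
move=> amen lfF homF k TA A TB Bs AgeA AgeB.
apply: canonical_on_compactness => //; first exact: Age_reduct.
by move=> c; apply: amenable_canonical_on => //; exact: AgeA.1.
Qed.

End RelativeAmenability.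

Theorem theorem2 (L : signature) (I : countType) (alpha : I -> nat)
    (F : structure L nat) (Fs : structure (expand L alpha) nat)
    (F_fraisse : fraisse F)
    (Fs_expansion : reduct Fs = F)
    (Fs_fraisse : fraisse Fs)
    (Fs_precompact : precompact_expansion F Fs) :
  relatively_extremely_amenable (aut_of_expansion F Fs) <->
  (forall (TA : Type) (As : structure (expand L alpha) TA),
     Age Fs As -> rigid As) /\
  relative_ramsey_emb (Age F) (Age Fs).
Proof.
subst F; case: F_fraisse => _ _ lfF homF; case: Fs_fraisse => _ _ lfFs homFs.
split=> [amen|[_ RR]]; last exact: relative_ramsey_amenable.
have RR := amenable_relative_ramsey amen lfF homFs.
by split=> // TA As; exact: relative_ramsey_rigid.
Qed.
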